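(* Let $\mathsf{P}\subset\mathrm{Top}$ be a full subcategory containing all compact Hausdorff spaces, and let $X$ be a completely regular Hausdorff topological space. Then $X$ admits a functorial $\mathsf{P}$-ification if and only if $\tilde\nu_{\mathsf{P}}X$ belongs to $\mathsf{P}$.
   Context: $\mathrm{Top}$ denotes the category of completely regular Hausdorff topological spaces and continuous maps; all spaces are assumed to be such. Full subcategories $\mathsf{P}\subset\mathrm{Top}$ stand for topological properties, hence are understood to be closed under homeomorphism. A space $X$ admits a functorial $\mathsf{P}$-ification $i_X: X\to\nu_{\mathsf{P}}X$ if $\nu_{\mathsf{P}}X\in\mathsf{P}$, $i_X$ is continuous, and for every $Y\in\mathsf{P}$ and every continuous map $f:X\to Y$ there is a unique continuous map $\tilde f:\nu_{\mathsf{P}}X\to Y$ with $f=\tilde f\circ i_X$. $\beta X$ is the Stone–Čech compactification of $X$, and $\beta f:\beta X\to\beta Y$ is the map induced by a continuous map $f:X\to Y$. Define the subspace $$\tilde\nu_{\mathsf{P}}X=\bigcap\{(\beta f)^{-1}(Y)\mid f:X\to Y \text{ is a continuous map with } Y\in\mathsf{P}\}\subset\beta X,$$ where $Y$ is regarded as a subspace of $\beta Y$. *)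

(* Defs.v *)
From HB Require Import structures.
From mathcomp Require Import all_boot all_order all_algebra.
From mathcomp Require Import all_classical all_reals topology normedtype.

Set Implicit Arguments.
Unset Strict Implicit.
Unset Printing Implicit Defensive.

Import Order.TTheory GRing.Theory Num.Theory.
Import numFieldNormedType.Exports.
Local Open Scope classical_set_scope.
Local Open Scope ring_scope.

Definition tychonoff_space (X : topologicalType) : Prop :=
  completely_regular_space X /\ hausdorff_space X.

Definition homeomorphic (X Y : topologicalType) : Prop :=
  exists (f : continuousType X Y) (g : continuousType Y X),
    cancel f g /\ cancel g f.

(* A full subcategory of Top closed under homeomorphism, given by its class of
   objects. *)
Definition topological_property (P : topologicalType -> Prop) : Prop :=
  (forall Y, P Y -> tychonoff_space Y) /\
  (forall Y Z, homeomorphic Y Z -> P Y -> P Z).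

Definition admits_functorial_ification
    (P : topologicalType -> Prop) (X : topologicalType) : Prop :=
  exists (nuX : topologicalType) (i : continuousType X nuX),
    P nuX /\
    forall (Y : topologicalType) (f : continuousType X Y), P Y ->
      exists! ft : continuousType nuX Y, f = ft \o i :> (X -> Y).

(* The Stone-Cech compactification, constructed as the closure of the image of
   the evaluation map X -> I^C(X, I), where I = [0, 1] and I^C(X, I) has the
   product topology. *)
Section StoneCech.
Variable R : realType.

Definition unit_interval : topologicalType := set_type `[0%R : R, 1%R].

Definition cube (X : topologicalType) : topologicalType :=
  {ptws continuousType X unit_interval -> unit_interval}.

Definition evaluation (X : topologicalType) (x : X) : cube X := fun g => g x.

Definition stone_cech (X : topologicalType) : topologicalType :=
  set_type (closure (range (@evaluation X))).

Definition stone_cech_unit (X : topologicalType) (x : X) : stone_cech X :=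
  SigSub (mem_set (subset_closure (imageT (@evaluation X) x))).

Definition cube_map (X Y : topologicalType) (f : continuousType X Y)
  (p : cube X) : cube Y := fun g => p (g \o f).

Lemma cube_map_continuous (X Y : topologicalType) (f : continuousType X Y) :
  continuous (cube_map f).
Proof.
move=> p; have FF : Filter (cube_map f @ p) by apply: fmap_filter; exact: nbhs_filter.
apply/cvg_sup => g U [_ [[V oV <-] /= Vpg] VU].
apply: (filterS (P := (fun q : cube X => q (g \o f)) @^-1` V)).
  by move=> q Vq; exact: VU.
have := @proj_continuous (continuousType X unit_interval)
  (fun=> unit_interval) (g \o f) p; apply.
exact: open_nbhs_nbhs.
Qed.

Lemma cube_map_closure (X Y : topologicalType) (f : continuousType X Y)
    (p : cube X) :
  closure (range (@evaluation X)) p ->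
  closure (range (@evaluation Y)) (cube_map f p).
Proof.
move=> clp B /(@cube_map_continuous _ _ f p) /clp[_ [[x _ <-] Bx]].
by exists (evaluation (f x)); split.
Qed.

(* beta f : beta X -> beta Y is p |-> (g |-> p (g \o f)), the restriction of
   the map of cubes induced by precomposition with f. *)
Definition stone_cech_map (X Y : topologicalType) (f : continuousType X Y)
    (p : stone_cech X) : stone_cech Y :=
  SigSub (mem_set (cube_map_closure (f := f) (set_valP p))).

Lemma stone_cech_map_unit (X Y : topologicalType) (f : continuousType X Y)
    (x : X) :
  stone_cech_map f (stone_cech_unit x) = stone_cech_unit (f x).
Proof. exact: val_inj. Qed.

(* Y is regarded as a subspace of beta Y via stone_cech_unit. *)
Definition nu_tilde (P : topologicalType -> Prop) (X : topologicalType) :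
    set (stone_cech X) :=
  [set p | forall (Y : topologicalType) (f : continuousType X Y), P Y ->
    (stone_cech_map f @^-1` range (@stone_cech_unit Y)) p].

End StoneCech.

(* Main.v *)
Require Import Defs.
From mathcomp Require Import all_boot all_order all_algebra.
From mathcomp Require Import all_classical all_reals topology normedtype.
Import Order.TTheory GRing.Theory Num.Theory.
Import numFieldNormedType.Exports.

Local Open Scope classical_set_scope.

(** The universal property forces a P-ification M of X, when there is one, to
    be the subspace N = nu_tilde P X of beta X.

    Every f : X -> Y with Y in P extends to N: by the definition of N, beta f
    sends N into the copy of Y in beta Y, and since Y is completely regular
    that copy carries the topology of Y, so beta f restricts to a continuous
    N -> Y (nu_tilde_extension). The extension is unique because X is dense in
    N and Y is Hausdorff. Hence N is a P-ification as soon as it lies in P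
    (nu_tilde_ification).

    Conversely let i : X -> M be a P-ification. As beta X is compact Hausdorff
    it lies in P, so the unit X -> beta X factors as g \o i. The maps
    beta i \o g and the unit of M agree on the image of i and have the target
    beta M, again in P, so they are equal. For f = ft \o i with target in P
    this gives beta f (g m) = beta ft (beta i (g m)) = beta ft m = ft m, so g
    takes its values in N. On the other side i itself extends to k : N -> M.
    Then k \o g is the identity because M embeds in beta M, and g \o k is the
    identity because it is so on the dense image of X; thus N is homeomorphic
    to M and lies in P (ification_nu_tilde). *)

(** * Subspaces and dense images *)

Lemma set_val_continuous {T : topologicalType} (A : set T) :
  continuous (set_val : set_type A -> T).
Proof. exact: initial_continuous. Qed.

Lemma continuous_to_set_type {S T : topologicalType} (A : set T)
    (f : S -> set_type A) :
  continuous (fun x => set_val (f x)) -> continuous f.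
Proof. exact: (@continuous_comp_initial _ _ _ set_val). Qed.

Lemma hausdorff_injective {S T : topologicalType} (f : S -> T) :
  continuous f -> injective f -> hausdorff_space T -> hausdorff_space S.
Proof.
move=> cf injf hT p q pq; apply: injf; apply: hT => U V Up Vq.
have [x [Ux Vx]] := pq _ _ (cf _ _ Up) (cf _ _ Vq).
by exists (f x).
Qed.

Lemma hausdorff_set_type {T : topologicalType} (A : set T) :
  hausdorff_space T -> hausdorff_space (set_type A).
Proof.
by apply: hausdorff_injective; [exact: set_val_continuous|exact: val_inj].
Qed.

(** A proper filter on the subspace pushes forward to one containing A; a
    cluster point in A of the image is a cluster point of the original filter
    because neighbourhoods in A are traces of neighbourhoods in T. *)
Lemma compact_set_type {T : topologicalType} (A : set T) :
  compact A -> compact [set: set_type A].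
Proof.
move=> cA F PF FT.
have FA : F (set_val @^-1` A) by apply: filterS FT => x _; exact: set_valP.
have [x [Ax clx]] := cA (set_val @ F) _ FA.
exists (SigSub (mem_set Ax)); split=> // U V FU.
move=> [_ [[W oW <-] Wx] WV].
have FU' : F (set_val @^-1` (set_val @` U)).
  by apply: filterS FU => y Uy; exists y.
have [_ [[y Uy <-] Wy]] := clx _ _ FU' (open_nbhs_nbhs (conj oW Wx)).
by exists y; split=> //; exact: WV.
Qed.

(** Density of an image can be tested in the ambient space, which serves both
    for X in beta X and for X in a subspace between X and beta X. *)
Lemma dense_in_set_type {X : Type} {T : topologicalType} (A : set T)
    (e : X -> set_type A) :
  A `<=` closure (range (fun x => set_val (e x))) -> closure (range e) = setT.
Proof.
move=> Acl; apply/seteqP; split=> // p _ U [_ [[W oW <-] Wp] WU].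
have [_ [[x _ <-] Wx]] := Acl _ (set_valP p) _ (open_nbhs_nbhs (conj oW Wp)).
by exists (e x); split; [exists x|exact: WU].
Qed.

Lemma eq_on_dense_range {X : Type} {S T : topologicalType} (e : X -> S)
    (f g : S -> T) :
  hausdorff_space T -> closure (range e) = setT ->
  continuous f -> continuous g -> (forall x, f (e x) = g (e x)) -> f =1 g.
Proof.
move=> hT de cf cg fg p; apply: hT => U V Uf Vg.
have clp : closure (range e) p by rewrite de.
have UVp : nbhs p (f @^-1` U `&` g @^-1` V).
  by apply: filterI; [exact: cf|exact: cg].
have [_ [[x _ <-] [Ux Vx]]] := clp _ UVp.
by exists (f (e x)); split=> //; rewrite fg.
Qed.

(** * The Stone-Cech compactification *)

Section StoneCechTheory.
Context {R : realType}.

Lemma unit_interval_hausdorff : hausdorff_space (unit_interval R).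
Proof. exact/hausdorff_set_type/Rhausdorff. Qed.

Lemma unit_interval_compact : compact [set: unit_interval R].
Proof. exact/compact_set_type/segment_compact. Qed.

Lemma cube_hausdorff (X : topologicalType) : hausdorff_space (cube R X).
Proof. by apply: hausdorff_product => _; exact: unit_interval_hausdorff. Qed.

Lemma cube_compact (X : topologicalType) : compact [set: cube R X].
Proof.
have := @tychonoff (continuousType X (unit_interval R))
  (fun=> unit_interval R) (fun=> setT) (fun=> unit_interval_compact).
by congr compact; apply/seteqP; split.
Qed.

Lemma continuous_to_cube {Z X : topologicalType} (F : Z -> cube R X) :
  (forall g, continuous (fun z => F z g)) -> continuous F.
Proof.
move=> cF z; have FF : Filter (F @ z) by exact: fmap_filter.
apply/cvg_sup => g U [_ [[V oV <-] /= Vg] VU].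
apply: (filterS (P := (fun z => F z g) @^-1` V)); first by move=> t; exact: VU.
by apply: cF; exact: open_nbhs_nbhs.
Qed.

Lemma coordinate_continuous {X : topologicalType}
    (g : continuousType X (unit_interval R)) :
  continuous (fun p : cube R X => p g).
Proof.
exact: (@proj_continuous (continuousType X (unit_interval R))
  (fun=> unit_interval R) g).
Qed.

Lemma stone_cech_hausdorff (X : topologicalType) :
  hausdorff_space (stone_cech R X).
Proof. exact/hausdorff_set_type/cube_hausdorff. Qed.

Lemma stone_cech_compact (X : topologicalType) :
  compact [set: stone_cech R X].
Proof.
apply: compact_set_type; rewrite -[X in compact X]setTI.
by apply: compact_closedI; [exact: cube_compact|exact: closed_closure].
Qed.

Lemma stone_cech_unit_continuous (X : topologicalType) :
  continuous (stone_cech_unit R (X := X)).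
Proof.
by apply: continuous_to_set_type; apply: continuous_to_cube => g; exact: cts_fun.
Qed.

Lemma stone_cech_map_continuous {X Y : topologicalType}
    (f : continuousType X Y) : continuous (stone_cech_map (R := R) f).
Proof.
apply: continuous_to_set_type => p; apply: continuous_comp.
  exact: set_val_continuous.
exact: cube_map_continuous.
Qed.

Lemma stone_cech_map_comp {X Y Z : topologicalType} (f : continuousType X Y)
    (g : continuousType Y Z) (p : stone_cech R X) :
  stone_cech_map (g \o f) p = stone_cech_map g (stone_cech_map f p).
Proof.
apply: val_inj; apply: functional_extensionality_dep => h /=.
by rewrite /cube_map; congr (set_val p _); exact/continuousEP.
Qed.

(** The coordinates of the cube are maps into the unit interval, so complete
    regularity is needed in this form, with strict sublevel sets as a base of
    neighbourhoods. *)
Lemma unit_interval_separation {Y : topologicalType} (y : Y) (U : set Y) :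
  completely_regular_space Y -> nbhs y U ->
  exists2 g : continuousType Y (unit_interval R),
    (set_val (g y) < 1)%R &
    forall z, (set_val (g z) < 1)%R -> U z.
Proof.
move=> crY Uy.
have ncy : ~ (~` U°) y by apply; exact: Uy.
have := crY y _ (open_closedC (open_interior U)) ncy.
move=> /(uniform_separatorP (R := R))[f [cf f01 f0 f1]].
have fI z : f z \in `[0%R, 1%R]%classic by apply/mem_set/f01; exists z.
pose g (z : Y) : unit_interval R := SigSub (fI z).
have cg : continuous g by apply: continuous_to_set_type.
have fy0 : f y = 0%R by apply: f0; exists y.
exists (mkcts cg); first by rewrite [X in (X < _)%R]fy0 ltr01.
move=> z fz1; apply: contrapT => nUz.
have fz : f z = 1%R by apply: f1; exists z => // /interior_subset.
by move: fz1; rewrite [X in (X < _)%R]fz ltxx.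
Qed.

(** This is the statement that the unit of a completely regular space is
    initial. Each neighbourhood of a point contains {g < 1} for some
    g : Y -> [0, 1], which is the trace on Y of an open condition on the
    coordinate g of beta Y. *)
Lemma continuous_from_stone_cech {Z Y : topologicalType} (r : Z -> Y) :
  completely_regular_space Y ->
  continuous (fun z => stone_cech_unit R (r z)) -> continuous r.
Proof.
move=> crY cr z U /(unit_interval_separation _ _ crY)[g g1 gU].
pose h p := set_val (set_val (p : stone_cech R Y) g).
have ch : continuous h.
  have c1 := @set_val_continuous (cube R Y) (closure (range (@evaluation R Y))).
  have c2 := coordinate_continuous g.
  have c3 := @set_val_continuous R `[0%R, 1%R].
  by move=> p; have := continuous_comp (continuous_comp (c1 p) (c2 _)) (c3 _).
have : nbhs (stone_cech_unit R (r z)) (h @^-1` [set x | (x < 1)%R]).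
  by apply: ch; apply: open_nbhs_nbhs; split=> //; exact: open_lt.
move=> /cr hz; suff : nbhs z (r @^-1` U) by [].
by apply: (@filterS _ (nbhs z)) hz => t; exact: gU.
Qed.

Lemma stone_cech_unit_injective {Y : topologicalType} :
  tychonoff_space Y -> injective (stone_cech_unit R (X := Y)).
Proof.
move=> [crY hY] x y xy; apply: hY => U V /(unit_interval_separation _ _ crY).
move=> [g g1 gU] /nbhs_singleton Vy; exists y; split=> //; apply: gU.
have := congr1 (fun p : stone_cech R Y => set_val (set_val p g)) xy.
by rewrite /= /evaluation => <-.
Qed.

End StoneCechTheory.

(** * The subspace of beta X and its universal property *)

Section NuTilde.
Context {R : realType} {P : topologicalType -> Prop} {X : topologicalType}.
Hypothesis P_property : topological_property P.

Local Notation N := (set_type (@nu_tilde R P X)).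

Lemma nu_tilde_stone_cech_unit (x : X) : nu_tilde P (stone_cech_unit R x).
Proof.
by move=> Y f PY; exists (f x) => //; rewrite stone_cech_map_unit.
Qed.

Definition nu_tilde_unit (x : X) : N :=
  SigSub (mem_set (nu_tilde_stone_cech_unit x)).

Lemma nu_tilde_unit_continuous : continuous nu_tilde_unit.
Proof. exact/continuous_to_set_type/stone_cech_unit_continuous. Qed.

(** X is dense in the whole of beta X, which is by construction the closure of
    its image in the cube. *)
Lemma nu_tilde_unit_dense : closure (range nu_tilde_unit) = setT.
Proof.
apply: dense_in_set_type => p _; move: p.
suff -> : closure (range (stone_cech_unit R (X := X))) = setT by [].
exact: dense_in_set_type.
Qed.

(** The extension is the restriction of beta f: membership in nu_tilde says
    exactly that beta f takes its value in Y. The second equation is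
    what makes the extension of a P-ification of X invert the map from it to
    beta X. *)
Lemma nu_tilde_extension {Y : topologicalType} (f : continuousType X Y) :
  P Y -> exists2 h : continuousType N Y,
    forall x, h (nu_tilde_unit x) = f x &
    forall p, stone_cech_unit R (h p) = stone_cech_map f (set_val p).
Proof.
move=> PY; have tY := P_property.1 _ PY.
have hP (p : N) : exists y, stone_cech_unit R y = stone_cech_map f (set_val p).
  by have [y _ <-] := set_valP p _ f PY; exists y.
have [h hE] := choice hP.
have ch : continuous h.
  apply: (@continuous_from_stone_cech R _ _ _ tY.1); rewrite (funext hE) => p.
  apply: continuous_comp; first exact: set_val_continuous.
  exact: stone_cech_map_continuous.
exists (mkcts ch) => //= x; apply: (@stone_cech_unit_injective R _ tY).
by rewrite hE stone_cech_map_unit.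
Qed.

Lemma nu_tilde_ification : P N -> admits_functorial_ification P X.
Proof.
move=> PN; exists N, (mkcts nu_tilde_unit_continuous); split=> // Y f PY.
have [h hE _] := nu_tilde_extension f PY.
exists h; split=> [|k fk]; first by apply/funext => x /=; rewrite hE.
apply/continuousEP; apply: (eq_on_dense_range _ _ _ _ nu_tilde_unit_dense).
- exact: (P_property.1 _ PY).2.
- exact: cts_fun.
- exact: cts_fun.
- by move=> x; rewrite hE fk.
Qed.

Hypothesis P_compact : forall K : topologicalType,
  compact [set: K] -> hausdorff_space K -> P K.

Lemma stone_cech_property (Y : topologicalType) : P (stone_cech R Y).
Proof.
by apply: P_compact; [exact: stone_cech_compact|exact: stone_cech_hausdorff].
Qed.

(** The homeomorphism is the extension g : M -> beta X of the unit of X,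
    corestricted to nu_tilde, with the extension k of i as its inverse. *)
Lemma ification_nu_tilde : admits_functorial_ification P X -> P N.
Proof.
move=> [M [i [PM univ]]].
(* Uniqueness of extensions makes i an epimorphism towards spaces in P. *)
have epi (Y : topologicalType) (f g : continuousType M Y) :
    P Y -> (forall x, f (i x) = g (i x)) -> f =1 g.
  move=> PY fg; have [h [_ uniq_ext]] := univ _ (g \o i) PY.
  apply/continuousEP; rewrite -(uniq_ext g)// -(uniq_ext f)//.
  by apply/funext => x /=; rewrite fg.
have [g [ge _]] := univ _ (mkcts (@stone_cech_unit_continuous R X))
  (stone_cech_property X).
have gi x : g (i x) = stone_cech_unit R x by rewrite -[LHS]/((g \o i) x) -ge.
have big : forall m, stone_cech_map i (g m) = stone_cech_unit R m.
  pose big := @mkcts _ _ _ (@stone_cech_map_continuous R _ _ i) \o g.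
  apply: (epi _ big (mkcts (@stone_cech_unit_continuous R M))
    (stone_cech_property M)) => x.
  by rewrite -[LHS]/(stone_cech_map i (g (i x))) gi stone_cech_map_unit.
have gN m : nu_tilde P (g m).
  move=> Y f PY; have [ft [fE _]] := univ _ f PY.
  have -> : f = ft \o i by apply/continuousEP => x; rewrite fE.
  by exists (ft m) => //; rewrite stone_cech_map_comp big stone_cech_map_unit.
pose G m : N := SigSub (mem_set (gN m)).
have cG : continuous G by apply: continuous_to_set_type; exact: cts_fun.
have [k ki kE] := nu_tilde_extension i PM.
apply: (P_property.2 M _ _ PM); exists (mkcts cG), k; split=> [m|] /=.
  apply: (@stone_cech_unit_injective R _ (P_property.1 _ PM)).
  by rewrite kE big.
apply: (eq_on_dense_range _ (G \o k) id _ nu_tilde_unit_dense) => //.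
- exact/hausdorff_set_type/stone_cech_hausdorff.
- by move=> p; apply: continuous_comp; [exact: cts_fun|exact: cG].
- by move=> p.
- by move=> x /=; rewrite ki; apply: val_inj; exact: gi.
Qed.

End NuTilde.

Theorem lemma1p9 (R : realType) (P : topologicalType -> Prop)
    (P_property : topological_property P)
    (P_compact : forall K : topologicalType,
       compact [set: K] -> hausdorff_space K -> P K)
    (X : topologicalType) (X_tychonoff : tychonoff_space X) :
  admits_functorial_ification P X <-> P (set_type (@nu_tilde R P X)).
Proof.
split; first exact: ification_nu_tilde P_property P_compact.
exact: nu_tilde_ification P_property.
Qed.
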